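(* For each odd prime $p$, the group $$\mathscr G_{HB_2^{(2)}}(p)=\langle a,b,c\mid a^p,b^p,c^p,[a,b,a],[a,b,b],[c,b,c],[c,b,b,c],[c,b,b,b],[c,a,c],[c,a,a,c],[c,a,a,a]\rangle$$ has finite simple quotients of arbitrarily large rank.
   Context: Commutators: $[x,y]=x^{-1}y^{-1}xy$, and $[x_1,\dots,x_n]=[[\dots[[x_1,x_2],x_3],\dots],x_n]$. For an integer $d$, let $\mathscr S_d$ be the collection of those finite simple groups that contain an isomorphic copy of the alternating group $\mathrm{Alt}(d)$. A group is said to have finite simple quotients of arbitrarily large rank if, for every $d$, it admits a quotient group belonging to $\mathscr S_d$. *)

(* Defs.v *)
(* The classical axioms of boolp are used because equality in a finitely
   presented group is undecidable in general. *)
From HB Require Import structures.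
From mathcomp Require Import all_boot all_fingroup all_solvable.
From mathcomp Require Import boolp.

Set Implicit Arguments.
Unset Strict Implicit.
Unset Printing Implicit Defensive.

Local Open Scope group_scope.
Local Open Scope quotient_scope.

(* fingroup's repr (on sets) shadows the one of quotient types. *)
Local Notation qrepr := generic_quotient.repr.

Section Words.
Variable X : Type.

Inductive gword :=
  | WGen of X
  | WOne
  | WMul of gword & gword
  | WInv of gword.

HB.instance Definition _ := gen_eqMixin gword.
HB.instance Definition _ := gen_choiceMixin gword.

(* These three instances carry no axioms (gword is only a baseGroupType); they
   make 1, *, ^-1, ^+ and [~ x, y, .., z] available for writing relators. *)
HB.instance Definition _ := hasMul.Build gword WMul.
HB.instance Definition _ := hasOne.Build gword WOne.
HB.instance Definition _ := hasInv.Build gword WInv.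

(* The least congruence on words that satisfies the group axioms and kills all
   relators: two words are related iff they represent the same element of
   < X | R >. *)
Inductive pres_eq (R : seq gword) : gword -> gword -> Prop :=
  | PresRefl u : pres_eq R u u
  | PresSym u v : pres_eq R u v -> pres_eq R v u
  | PresTrans u v w : pres_eq R u v -> pres_eq R v w -> pres_eq R u w
  | PresMul u u' v v' :
      pres_eq R u u' -> pres_eq R v v' -> pres_eq R (u * v) (u' * v')
  | PresInv u u' : pres_eq R u u' -> pres_eq R u^-1 u'^-1
  | PresMulA u v w : pres_eq R (u * (v * w)) (u * v * w)
  | PresMul1g u : pres_eq R (1 * u) u
  | PresMulg1 u : pres_eq R (u * 1) u
  | PresMulVg u : pres_eq R (u^-1 * u) 1
  | PresMulgV u : pres_eq R (u * u^-1) 1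
  | PresRel r : r \in R -> pres_eq R r 1.

End Words.

Section PresentedGroup.
Variables (X : Type) (R : seq (gword X)).

Definition pres_eqb (u v : gword X) : bool := `[< pres_eq R u v >].

Lemma pres_eqb_refl : reflexive pres_eqb.
Proof. by move=> u; apply/asboolP; apply: PresRefl. Qed.

Lemma pres_eqb_sym : symmetric pres_eqb.
Proof. by move=> u v; apply/asboolP/asboolP; apply: PresSym. Qed.

Lemma pres_eqb_trans : transitive pres_eqb.
Proof.
by move=> v u w /asboolP uv /asboolP vw; apply/asboolP; apply: PresTrans vw.
Qed.

Canonical pres_equiv :=
  EquivRel pres_eqb pres_eqb_refl pres_eqb_sym pres_eqb_trans.

Definition presented : Type := {eq_quot pres_equiv}.

HB.instance Definition _ := Choice.on presented.
HB.instance Definition _ := Quotient.on presented.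

Definition pres_class (u : gword X) : presented := \pi_presented u.

Lemma pres_classP u v : pres_class u = pres_class v <-> pres_eq R u v.
Proof.
split=> [/eqquotP/asboolP // | uv]; apply/eqquotP; exact/asboolP.
Qed.

Lemma pres_repr (x : presented) : pres_class (qrepr x) = x.
Proof. exact: reprK. Qed.

Lemma pres_reprP u : pres_eq R (qrepr (pres_class u)) u.
Proof. by apply/pres_classP; rewrite pres_repr. Qed.

Definition pres_mul (x y : presented) : presented :=
  pres_class (qrepr x * qrepr y).
Definition pres_one : presented := pres_class 1.
Definition pres_inv (x : presented) : presented := pres_class (qrepr x)^-1.

Lemma pres_class_mul u v :
  pres_mul (pres_class u) (pres_class v) = pres_class (u * v).
Proof. by apply/pres_classP; apply: PresMul; apply: pres_reprP. Qed.

Lemma pres_class_inv u : pres_inv (pres_class u) = pres_class u^-1.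
Proof. by apply/pres_classP; apply: PresInv; apply: pres_reprP. Qed.

Lemma pres_mulA : associative pres_mul.
Proof.
move=> x y z; rewrite -(pres_repr x) -(pres_repr y) -(pres_repr z).
by rewrite !pres_class_mul; apply/pres_classP; apply: PresMulA.
Qed.

Lemma pres_mul1g : left_id pres_one pres_mul.
Proof.
move=> x; rewrite -(pres_repr x) pres_class_mul.
by apply/pres_classP; apply: PresMul1g.
Qed.

Lemma pres_mulg1 : right_id pres_one pres_mul.
Proof.
move=> x; rewrite -(pres_repr x) pres_class_mul.
by apply/pres_classP; apply: PresMulg1.
Qed.

Lemma pres_mulVg : left_inverse pres_one pres_inv pres_mul.
Proof.
move=> x; rewrite -(pres_repr x) pres_class_inv pres_class_mul.
by apply/pres_classP; apply: PresMulVg.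
Qed.

Lemma pres_mulgV : right_inverse pres_one pres_inv pres_mul.
Proof.
move=> x; rewrite -(pres_repr x) pres_class_inv pres_class_mul.
by apply/pres_classP; apply: PresMulgV.
Qed.

HB.instance Definition _ := isGroup.Build presented
  pres_mulA pres_mul1g pres_mulg1 pres_mulVg pres_mulgV.

End PresentedGroup.

Section UniversalProperty.
Variables (X : Type) (R : seq (gword X)) (H : groupType) (f : X -> H).

Fixpoint gword_eval (u : gword X) : H :=
  match u with
  | WGen x => f x
  | WOne => 1
  | WMul u v => gword_eval u * gword_eval v
  | WInv u => (gword_eval u)^-1
  end.

Hypothesis fR : forall r, r \in R -> gword_eval r = 1.

Lemma gword_eval_pres_eq u v : pres_eq R u v -> gword_eval u = gword_eval v.
Proof.
elim=> //=.
- by move=> u1 v1 w1 _ -> _ ->.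
- by move=> u1 u2 v1 v2 _ -> _ ->.
- by move=> u1 u2 _ ->.
- by move=> u1 v1 w1; rewrite mulgA.
- by move=> u1; rewrite mul1g.
- by move=> u1; rewrite mulg1.
- by move=> u1; rewrite mulVg.
- by move=> u1; rewrite mulgV.
Qed.

Lemma presented_universal :
  exists F : {multiplicative presented R -> H},
    forall x, F (pres_class R (WGen x)) = f x.
Proof.
pose F (z : presented R) := gword_eval (qrepr z).
have Fclass u : F (pres_class R u) = gword_eval u.
  exact/gword_eval_pres_eq/pres_reprP.
have FM : {morph F : x y / x * y} by move=> x y; apply: Fclass.
pose mF := isMultiplicative.Build (presented R) H F FM.
pose sF : {multiplicative presented R -> H} := HB.pack F mF.
by exists sF => x; apply: Fclass.
Qed.

End UniversalProperty.

(* Membership of the finite group S in the class S_d. *)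
Definition simple_containing_Alt (d : nat) (gT : finGroupType)
    (S : {group gT}) : Prop :=
  simple S /\ exists2 A : {group gT}, A \subset S & 'Alt_('I_d) \isog A.

(* S is (isomorphic to) a quotient of the possibly infinite group G. *)
Definition finite_quotient (G : groupType) (gT : finGroupType)
    (S : {group gT}) : Prop :=
  exists f : {multiplicative G -> gT}, forall y, y \in S <-> exists x, f x = y.

Definition simple_quotients_of_large_rank (G : groupType) : Prop :=
  forall d : nat, exists (gT : finGroupType) (S : {group gT}),
    finite_quotient G S /\ simple_containing_Alt d S.

Variant abc := GenA | GenB | GenC.

Definition HB22_relators (p : nat) : seq (gword abc) :=
  let a := WGen GenA in let b := WGen GenB in let c := WGen GenC in
  [:: a ^+ p; b ^+ p; c ^+ p;
      [~ a, b, a]; [~ a, b, b];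
      [~ c, b, c]; [~ c, b, b, c]; [~ c, b, b, b];
      [~ c, a, c]; [~ c, a, a, c]; [~ c, a, a, a]].

Definition G_HB22 (p : nat) : groupType := presented (HB22_relators p).

(* Main.v *)
(* The group acts on four-tuples (x, y, m, o) of vectors over F_p by
     a : (x, y, m, o) |-> (x, y + o, m + x, o),
     b : (x, y, m, o) |-> (x, y + F m, m, o + G x),
     c : (x, y, m, o) |-> (x + y, y, m, o),
   which satisfies the relations for all linear maps F and G.  Take for G the
   permutation matrix of a cycle of length n, and F = G + E_00.  Then [a, b] is
   the transvection y_0 += x_0; conjugating it by c and by itself gives
   x_0 += y_0, and commutators of its conjugates by a and b, spread along the
   cycle, give all elementary transvections.  So the image of the group contains
   the even permutations of the coordinates (acting simultaneously on x and y),
   a copy of Alt(n), and any normal subgroup containing this copy is the whole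
   image.  Hence the quotient by a maximal normal subgroup is a simple group in
   which Alt(n) embeds, and this group never has to be identified. *)
Require Import Defs.
From HB Require Import structures.
From mathcomp Require Import all_boot all_fingroup all_solvable all_algebra.
From mathcomp Require Import boolp ring.

Set Implicit Arguments.
Unset Strict Implicit.
Unset Printing Implicit Defensive.

Import GRing.Theory.
Local Open Scope ring_scope.

(** * The space of four-tuples and its standard bilinear form *)

Definition quadSpace (p n : nat) : Type :=
  ('rV['F_p]_n * 'rV['F_p]_n * 'rV['F_p]_n * 'rV['F_p]_n)%type.
HB.instance Definition _ p n := GRing.Lmodule.on (quadSpace p n).
HB.instance Definition _ p n := Finite.on (quadSpace p n).

Definition udot (p n : nat) (u v : 'rV['F_p]_n) : 'F_p := \sum_i u 0 i * v 0 i.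

Section Parts.
Variables (p n : nat) (v : quadSpace p n).
Definition xpart := v.1.1.1.
Definition ypart := v.1.1.2.
Definition mpart := v.1.2.
Definition opart := v.2.
End Parts.

(** Through this form linear functionals are written as vectors, so a transvection is given by two
    vectors. Locking keeps unification from unfolding it to sums over entries. *)
HB.lock Definition dot (p n : nat) (w v : quadSpace p n) : 'F_p :=
  udot (xpart w) (xpart v) + udot (ypart w) (ypart v)
  + (udot (mpart w) (mpart v) + udot (opart w) (opart v)).

(* The four coordinate blocks x, y, m, o are indexed by (false, false),
   (true, false), (false, true) and (true, true). *)
Definition vertex (n : nat) : Type := (bool * bool * 'I_n)%type.
HB.instance Definition _ n := Finite.on (vertex n).

Definition embed (p n : nat) (k : bool * bool) (u : 'rV['F_p]_n) : quadSpace p n :=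
  match k with
  | (false, false) => (u, 0, 0, 0)
  | (true, false) => (0, u, 0, 0)
  | (false, true) => (0, 0, u, 0)
  | (true, true) => (0, 0, 0, u)
  end.

Definition part (p n : nat) (k : bool * bool) (v : quadSpace p n) :=
  match k with
  | (false, false) => xpart v
  | (true, false) => ypart v
  | (false, true) => mpart v
  | (true, true) => opart v
  end.

HB.lock Definition basis (p n : nat) (t : vertex n) : quadSpace p n :=
  embed t.1 (delta_mx 0 t.2).

Section Space.
Variables (p n : nat).
Local Notation F := 'F_p.
Local Notation quadSpace := (quadSpace p n).
Implicit Types (u v w : quadSpace).

Lemma udotDr (w u v : 'rV[F]_n) : udot w (u + v) = udot w u + udot w v.
Proof. by rewrite /udot -big_split; apply: eq_bigr => i _; rewrite mxE mulrDr. Qed.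
Lemma udotZr (w u : 'rV[F]_n) k : udot w (k *: u) = k * udot w u.
Proof. by rewrite /udot mulr_sumr; apply: eq_bigr => i _; rewrite mxE mulrCA. Qed.
Lemma udotC (w u : 'rV[F]_n) : udot w u = udot u w.
Proof. by apply: eq_bigr => i _; rewrite mulrC. Qed.
Lemma udot_delta i (v : 'rV[F]_n) : udot (delta_mx 0 i) v = v 0 i.
Proof.
rewrite /udot (bigD1 i) //= mxE !eqxx mul1r big1 ?addr0 // => j ji.
by rewrite mxE (negPf ji) andbF mul0r.
Qed.

Lemma dotC w v : dot w v = dot v w.
Proof. by rewrite dot.unlock; congr (_ + _ + (_ + _)); apply: udotC. Qed.
Lemma dotDr w u v : dot w (u + v) = dot w u + dot w v.
Proof. by rewrite dot.unlock /= !udotDr; ring. Qed.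
Lemma dotZr w k v : dot w (k *: v) = k * dot w v.
Proof. by rewrite dot.unlock /= !udotZr; ring. Qed.
Lemma dotNr w v : dot w (- v) = - dot w v.
Proof. by rewrite -scaleN1r dotZr mulN1r. Qed.
Lemma dotDl w w' v : dot (w + w') v = dot w v + dot w' v.
Proof. by rewrite !(dotC _ v) dotDr. Qed.
Lemma dotZl w k v : dot (k *: w) v = k * dot w v.
Proof. by rewrite !(dotC _ v) dotZr. Qed.
Lemma dotNl w v : dot (- w) v = - dot w v.
Proof. by rewrite !(dotC _ v) dotNr. Qed.

Definition xvec (i : 'I_n) := basis p (false, false, i).
Definition yvec (i : 'I_n) := basis p (true, false, i).
Definition mvec (i : 'I_n) := basis p (false, true, i).
Definition ovec (i : 'I_n) := basis p (true, true, i).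

Lemma udot0 (v : 'rV[F]_n) : udot 0 v = 0.
Proof. by rewrite /udot big1 // => i _; rewrite mxE mul0r. Qed.

Lemma dot_basisl t v : dot (basis p t) v = part t.1 v 0 t.2.
Proof.
rewrite basis.unlock dot.unlock.
by case: t => [[[] []] i]; rewrite /= ?udot_delta ?udot0 ?addr0 ?add0r.
Qed.

Lemma dot_basis (s t : vertex n) : dot (basis p s) (basis p t) = (s == t)%:R.
Proof.
rewrite dot_basisl basis.unlock; case: s t => [[[] []] i] [[[] []] j];
by rewrite !xpair_eqE /= ?mxE ?eqxx.
Qed.

(** Nondegeneracy of the form. It lets the tactic [vec] check an identity between vectors as an
    identity between scalars, where [ring] applies. *)
Lemma dot_inj u v : (forall w, dot w u = dot w v) -> u = v.
Proof.
move=> uv; case: u v uv => [[[x y] m] o] [[[x1 y1] m1] o1] uv.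
have E k i := uv (basis p (k, i)).
by congr (_, _, _, _); apply/rowP => i;
  [have := E (false, false) i | have := E (true, false) i
  | have := E (false, true) i | have := E (true, true) i]; rewrite !dot_basisl.
Qed.

End Space.

Section DotExpansion.
Variables (p n : nat) (w u v : quadSpace p n) (k x y : 'F_p).
Hypotheses (ux : dot w u = x) (vy : dot w v = y).
Lemma dot_eqD : dot w (u + v) = x + y.
Proof. by rewrite dotDr ux vy. Qed.
Lemma dot_eqN : dot w (- u) = - x.
Proof. by rewrite dotNr ux. Qed.
Lemma dot_eqZ : dot w (k *: u) = k * x.
Proof. by rewrite dotZr ux. Qed.
End DotExpansion.

(* Rewriting with [dotDr] would try to unify sums with scalings by unfolding
   both to tuples of matrices, hence the syntactic matching. *)
Ltac dot_expand := lazymatch goal with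
  | |- dot ?w (?a + ?b) = _ =>
      refine (@dot_eqD _ _ w a b _ _ _ _); dot_expand
  | |- dot ?w (- ?a) = _ => refine (@dot_eqN _ _ w a _ _); dot_expand
  | |- dot ?w (?k *: ?a) = _ => refine (@dot_eqZ _ _ w a k _ _); dot_expand
  | |- _ => reflexivity
  end.
Ltac vec_eq := apply: dot_inj => ?;
  etransitivity; [dot_expand | symmetry; etransitivity; [dot_expand |]].
Ltac vec := vec_eq; ring.

(** * Transvections contained in a group of permutations *)

(** The pair (v, w) stands for the transvection with vector [v] and functional [w]. The condition
    [dot w v = 0] makes composition additive in [v] for fixed [w], and in [w] for fixed [v]. *)
HB.lock Definition has_transv (p n : nat) (K : {set {perm quadSpace p n}})
    (v w : quadSpace p n) : Prop :=
  dot w v = 0 /\ exists2 g, g \in K & forall z, g z = z + dot w z *: v.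

Section Transvections.
Variables (p n : nat).
Local Notation F := 'F_p.
Local Notation V := (quadSpace p n).

Section OneGroup.
Variable K : {group {perm V}}.
Local Notation T := (has_transv K).

Lemma transvP v w : T v w <->
  dot w v = 0 /\ exists2 g, g \in K & forall z, g z = z + dot w z *: v.
Proof. by rewrite has_transv.unlock. Qed.

Lemma transv_addl v v' w : T v w -> T v' w -> T (v + v') w.
Proof.
rewrite has_transv.unlock; move=> [wv [g Kg gE]] [wv' [g' Kg' gE']].
split; first by rewrite dotDr wv wv' addr0.
exists (g * g')%g; first exact: groupM.
move=> z; rewrite permM gE' gE; rewrite !dotDr !dotZr wv mulr0 addr0.
by rewrite scalerDr addrA.
Qed.

Lemma transv_addr v w w' : T v w -> T v w' -> T v (w + w').
Proof.
rewrite has_transv.unlock; move=> [wv [g Kg gE]] [wv' [g' Kg' gE']].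
split; first by rewrite dotDl wv wv' addr0.
exists (g * g')%g; first exact: groupM.
move=> z; rewrite permM gE' gE; rewrite !dotDr !dotZr wv' mulr0 addr0.
by rewrite dotDl scalerDl addrA.
Qed.

Lemma transv_swap k v w : T (k *: v) w <-> T v (k *: w).
Proof.
rewrite has_transv.unlock.
by split=> -[wv [g Kg gE]]; (split; first by move: wv; rewrite dotZl dotZr);
  exists g => // z; rewrite gE dotZl scalerA mulrC.
Qed.

Lemma transv0 w : T 0 w.
Proof.
rewrite has_transv.unlock; split; first by rewrite -(scale0r w) dotZr mul0r.
by exists 1%g => // z; rewrite perm1 scaler0 addr0.
Qed.

(** Each scalar of the prime field is a natural multiple of 1, so closure under sums suffices. *)
Lemma transv_scale k v w : T v w -> T (k *: v) w.
Proof.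
move=> Tvw; rewrite -[k]natr_Zp scaler_nat.
by elim: (nat_of_ord k) => [|m IH]; rewrite ?mulr0n ?mulrS;
  [apply: transv0 | apply: transv_addl].
Qed.

Lemma transv_scaler k v w : T v w -> T v (k *: w).
Proof. by move/(transv_scale k)/transv_swap. Qed.

Lemma transv_oppl v w : T v w -> T (- v) w.
Proof. by move/(transv_scale (-1)); rewrite scaleN1r. Qed.
Lemma transv_oppr v w : T v w -> T v (- w).
Proof. by move/(transv_scaler (-1)); rewrite scaleN1r. Qed.

Lemma transv_cancell v v' w : T v w -> T (v + v') w -> T v' w.
Proof.
move=> /transv_oppl Tv Tvv; have := transv_addl Tv Tvv.
by rewrite addKr.
Qed.

Lemma transv_cancelr v w w' : T v w -> T v (w + w') -> T v w'.
Proof.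
move=> /transv_oppr Tv Tvv; have := transv_addr Tv Tvv.
by rewrite addKr.
Qed.

(** Conjugation by a linear [g] moves [v] by [g] and [w] by the inverse transpose of [g]; [w'] is
    the latter image, characterised by adjunction so that no inverse has to be computed. *)
Lemma transv_conj g v w w' :
    g \in 'N(K)%g -> (forall k u z, g (u + k *: z) = g u + k *: g z) ->
    (forall z, dot w' (g z) = dot w z) ->
  T v w -> T (g v) w'.
Proof.
rewrite has_transv.unlock; move=> NKg gL gw [wv [h Kh hE]]; split; first by rewrite gw.
exists (h ^ g)%g; first by rewrite memJ_norm.
by move=> z; rewrite conjgE !permM hE gL permKV -gw permKV.
Qed.

End OneGroup.

Lemma transv_tconj (G K : {group {perm V}}) v w v' w' :
    G \subset 'N(K)%g -> has_transv G v w -> has_transv K v' w' ->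
  has_transv K (v' + dot w v' *: v) (w' - dot w' v *: w).
Proof.
move=> nKG /transvP[wv [g Gg gE]] TK.
rewrite -gE; apply: transv_conj TK; first exact: (subsetP nKG).
  by move=> k u z; rewrite !gE !dotDr !dotZr; vec.
move=> z; rewrite gE dotDl dotNl dotZl !dotDr !dotZr wv; ring.
Qed.

(** The analogue of [e_ij, e_jk] = e_ik. As [w'] kills [v], conjugation changes only the vector, and
    cancelling the original transvection leaves the commutator, which is in [K] because [G]
    normalises [K]. *)
Lemma transv_comm (G K : {group {perm V}}) v w v' w' :
    G \subset 'N(K)%g -> has_transv G v w -> has_transv K v' w' ->
    dot w' v = 0 ->
  has_transv K (dot w v' *: v) w'.
Proof.
move=> nKG TG TK wv; have := transv_tconj nKG TG TK.
by rewrite wv scale0r subr0; apply: transv_cancell.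
Qed.

(** The same commutator with the other factor in [K]; here conjugation changes only the
    functional. *)
Lemma transv_comm' (G K : {group {perm V}}) v w v' w' :
    G \subset 'N(K)%g -> has_transv K v w -> has_transv G v' w' ->
    dot w' v = 0 ->
  has_transv K (dot w v' *: v) w'.
Proof.
move=> nKG TK TG wv; have := transv_tconj nKG TG TK.
rewrite wv scale0r addr0 => /(transv_cancelr TK) /transv_oppr.
by rewrite opprK => /transv_swap.
Qed.

End Transvections.

(** * The generators and the defining relations *)

(** Products of permutations apply the left factor first, so s t = t s [s, t] says that the
    commutator carries [s (t v)] to [t (s v)]. This avoids inverses. *)
Lemma commg_permE (T : finType) (s t : {perm T}) (d : T -> T) :
  (forall v, t (s v) = d (s (t v))) -> forall v, [~ s, t]%g v = d v.
Proof.
move=> st v; rewrite -[v](permKV (t * s)%g).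
by move: (_ v) => u; rewrite -[LHS]permM -commgC !permM st.
Qed.

Lemma commg_perm1 (T : finType) (s t : {perm T}) :
  (forall v, t (s v) = s (t v)) -> [~ s, t]%g = 1%g.
Proof. by move=> st; apply/permP => v; rewrite perm1 (commg_permE (d := id)). Qed.

Section Generators.
Variables (p n : nat) (sigma : 'S_n) (i0 : 'I_n).
Local Notation F := 'F_p.
Local Notation U := 'rV[F]_n.
Local Notation V := (quadSpace p n).
Local Notation d i := (delta_mx 0 i : U).

(* G and F of the header, with their transposes. *)
Definition shift (u : U) : U := col_perm sigma^-1 u.
Definition shiftT (u : U) : U := col_perm sigma u.
Definition shift' (u : U) : U := shift u + u 0 i0 *: d i0.
Definition shift'T (u : U) : U := shiftT u + u 0 i0 *: d i0.

Definition fun_a (v : V) : V :=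
  (xpart v, ypart v + opart v, mpart v + xpart v, opart v).
Definition fun_b (v : V) : V :=
  (xpart v, ypart v + shift' (mpart v), mpart v, opart v + shift (xpart v)).
Definition fun_c (v : V) : V :=
  (xpart v + ypart v, ypart v, mpart v, opart v).

Lemma fun_a_inj : injective fun_a.
Proof.
pose g (v : V) : V := (xpart v, ypart v - opart v, mpart v - xpart v, opart v).
by apply: (can_inj (g := g)) => -[[[x y] m] o]; congr (_, _, _, _); apply: addrK.
Qed.
Lemma fun_b_inj : injective fun_b.
Proof.
pose g (v : V) : V :=
  (xpart v, ypart v - shift' (mpart v), mpart v, opart v - shift (xpart v)).
by apply: (can_inj (g := g)) => -[[[x y] m] o]; congr (_, _, _, _); apply: addrK.
Qed.
Lemma fun_c_inj : injective fun_c.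
Proof.
pose g (v : V) : V := (xpart v - ypart v, ypart v, mpart v, opart v).
by apply: (can_inj (g := g)) => -[[[x y] m] o]; congr (_, _, _, _); apply: addrK.
Qed.

Definition gen_a := perm fun_a_inj.
Definition gen_b := perm fun_b_inj.
Definition gen_c := perm fun_c_inj.

Lemma shiftD u v : shift (u + v) = shift u + shift v.
Proof. exact: raddfD. Qed.
Lemma shiftZ k v : shift (k *: v) = k *: shift v.
Proof. by apply/rowP => i; rewrite !mxE. Qed.
Lemma shiftN v : shift (- v) = - shift v.
Proof. by rewrite -scaleN1r shiftZ scaleN1r. Qed.
Lemma shift'D u v : shift' (u + v) = shift' u + shift' v.
Proof. by rewrite /shift' shiftD mxE scalerDl addrACA. Qed.
Lemma shift'Z k v : shift' (k *: v) = k *: shift' v.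
Proof. by rewrite /shift' shiftZ mxE scalerDr scalerA. Qed.

Lemma gen_a_lin k u v : gen_a (u + k *: v) = gen_a u + k *: gen_a v.
Proof.
rewrite !permE; case: u v => [[[x y] m] o] [[[x1 y1] m1] o1].
by congr (_, _, _, _) => /=; rewrite ?scalerDr // addrACA.
Qed.
Lemma gen_b_lin k u v : gen_b (u + k *: v) = gen_b u + k *: gen_b v.
Proof.
rewrite !permE; case: u v => [[[x y] m] o] [[[x1 y1] m1] o1].
by congr (_, _, _, _) => /=;
  rewrite ?shift'D ?shift'Z ?shiftD ?shiftZ ?scalerDr // addrACA.
Qed.
Lemma gen_c_lin k u v : gen_c (u + k *: v) = gen_c u + k *: gen_c v.
Proof.
rewrite !permE; case: u v => [[[x y] m] o] [[[x1 y1] m1] o1].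
by congr (_, _, _, _) => /=; rewrite ?scalerDr // addrACA.
Qed.

Ltac rows := apply/rowP => ?; rewrite ?mxE; ring.
Ltac coords := rewrite /shift' /=; rewrite ?(shiftD, shiftN, shiftZ); rows.

(** There are two routes from x to y: through m, where b contributes F, and through o, where b
    contributes G. Each product of a and b follows one of them, so the commutator adds (F - G) x,
    and F - G = E_00. *)
Lemma comm_ab v : [~ gen_a, gen_b]%g v = v + xpart v 0 i0 *: yvec p i0.
Proof.
pose dd (v : V) : V := (xpart v, ypart v + xpart v 0 i0 *: d i0, mpart v, opart v).
rewrite (commg_permE (d := dd)); last first.
  by move=> {}v; rewrite !permE; congr (_, _, _, _) => //=; coords.
by case: v => [[[x y] m] o]; rewrite /yvec basis.unlock;
congr (_, _, _, _) => /=; rewrite ?scaler0 ?addr0.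
Qed.

Lemma comm_cb v : [~ gen_c, gen_b]%g v =
  (xpart v - shift' (mpart v), ypart v, mpart v,
   opart v + shift (ypart v - shift' (mpart v))).
Proof.
move: v; apply: commg_permE => v.
by rewrite !permE; congr (_, _, _, _) => //=; coords.
Qed.

Lemma comm_cbb v : [~ gen_c, gen_b, gen_b]%g v =
  (xpart v, ypart v, mpart v, opart v - (shift (shift' (mpart v))) *+ 2).
Proof.
move: v; apply: commg_permE => v.
by rewrite !comm_cb !permE; congr (_, _, _, _) => //=; coords.
Qed.

Lemma comm_ca v : [~ gen_c, gen_a]%g v =
  (xpart v - opart v, ypart v, mpart v + ypart v - opart v, opart v).
Proof.
move: v; apply: commg_permE => v.
by rewrite !permE; congr (_, _, _, _) => //=; coords.
Qed.

Lemma comm_caa v : [~ gen_c, gen_a, gen_a]%g v =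
  (xpart v, ypart v, mpart v - opart v *+ 2, opart v).
Proof.
move: v; apply: commg_permE => v.
by rewrite !comm_ca !permE; congr (_, _, _, _) => //=; coords.
Qed.

Hypothesis p_pr : prime p.

Lemma rowMp (u : U) : u *+ p = 0.
Proof. by rewrite -scaler_nat (pcharf0 (pchar_Fp p_pr)) scale0r. Qed.

Lemma gen_a_exp : (gen_a ^+ p)%g = 1%g.
Proof.
have E k v : (gen_a ^+ k)%g v =
    (xpart v, ypart v + opart v *+ k, mpart v + xpart v *+ k, opart v).
  elim: k => [|k IH]; first by rewrite perm1 !addr0; case: v => [[[]]].
  rewrite expgSr permM IH permE; congr (_, _, _, _) => //=;
  by rewrite -addrA -mulrSr.
by apply/permP => v; rewrite E !rowMp !addr0 perm1; case: v => [[[]]].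
Qed.

Lemma gen_b_exp : (gen_b ^+ p)%g = 1%g.
Proof.
have E k v : (gen_b ^+ k)%g v =
   (xpart v, ypart v + shift' (mpart v) *+ k, mpart v, opart v + shift (xpart v) *+ k).
  elim: k => [|k IH]; first by rewrite perm1 !addr0; case: v => [[[]]].
  rewrite expgSr permM IH permE; congr (_, _, _, _) => //=;
  by rewrite -addrA -mulrSr.
by apply/permP => v; rewrite E !rowMp !addr0 perm1; case: v => [[[]]].
Qed.

Lemma gen_c_exp : (gen_c ^+ p)%g = 1%g.
Proof.
have E k v : (gen_c ^+ k)%g v = (xpart v + ypart v *+ k, ypart v, mpart v, opart v).
  elim: k => [|k IH]; first by rewrite perm1 !addr0; case: v => [[[]]].
  rewrite expgSr permM IH permE; congr (_, _, _, _) => //=;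
  by rewrite -addrA -mulrSr.
by apply/permP => v; rewrite E !rowMp !addr0 perm1; case: v => [[[]]].
Qed.

Definition gen (x : abc) : {perm V} :=
  match x with GenA => gen_a | GenB => gen_b | GenC => gen_c end.

(** On words [^+] is an iterated product without group laws, and [u ^+ 1] is [u] itself; hence the
    exponents 0 and 1 are separate base cases. *)
Lemma gword_eval_exp (X : Type) (H : groupType) (f : X -> H) u k :
  gword_eval f (u ^+ k)%g = (gword_eval f u ^+ k)%g.
Proof.
case: k => // k; elim: k => // k IH.
by rewrite [RHS]expgS -IH.
Qed.

Lemma gen_relators r : r \in HB22_relators p -> gword_eval gen r = 1%g.
Proof.
rewrite !inE => /or4P[/eqP->|/eqP->|/eqP->|
  /or4P[/eqP->|/eqP->|/eqP->|/or4P[/eqP->|/eqP->|/eqP->|/orP[]/eqP->]]].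
- by rewrite gword_eval_exp gen_a_exp.
- by rewrite gword_eval_exp gen_b_exp.
- by rewrite gword_eval_exp gen_c_exp.
(* Each remaining relator is a commutator, so it suffices that its last entry commutes with the
   inner commutator, whose action is already computed. *)
all: apply: commg_perm1 => v; rewrite ?comm_ab.
- rewrite !permE /yvec basis.unlock; congr (_, _, _, _) => //=; coords.
- rewrite !permE /yvec basis.unlock; congr (_, _, _, _) => //=; coords.
- rewrite !comm_cb !permE; congr (_, _, _, _) => //=; coords.
- rewrite !comm_cbb !permE; congr (_, _, _, _) => //=; coords.
- rewrite !comm_cbb !permE; congr (_, _, _, _) => //=; coords.
- rewrite !comm_ca !permE; congr (_, _, _, _) => //=; coords.
- rewrite !comm_caa !permE; congr (_, _, _, _) => //=; coords.
- rewrite !comm_caa !permE; congr (_, _, _, _) => //=; coords.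
Qed.

End Generators.

(** * The generators acting on basis vectors and on functionals *)

Section Elementary.
Variables (p n : nat) (sigma : 'S_n) (i0 : 'I_n).
Local Notation F := 'F_p.
Local Notation U := 'rV[F]_n.
Local Notation V := (quadSpace p n).
Local Notation xvec := (xvec p).
Local Notation yvec := (yvec p).
Local Notation mvec := (mvec p).
Local Notation ovec := (ovec p).
Local Notation ga := (gen_a p n).
Local Notation gb := (gen_b p sigma i0).
Local Notation gc := (gen_c p n).

(* The action of the generators on functionals, that is, inverse transposes. *)
Definition dual_a (w : V) : V :=
  (xpart w - mpart w, ypart w, mpart w, opart w - ypart w).
Definition dual_b (w : V) : V :=
  (xpart w - shiftT sigma (opart w), ypart w,
   mpart w - shift'T sigma i0 (ypart w), opart w).
Definition dual_c (w : V) : V :=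
  (xpart w, ypart w - xpart w, mpart w, opart w).

Lemma udotDl (w w' u : U) : udot (w + w') u = udot w u + udot w' u.
Proof. by rewrite !(udotC _ u) udotDr. Qed.
Lemma udotNl (w u : U) : udot (- w) u = - udot w u.
Proof. by rewrite -scaleN1r !(udotC _ u) udotZr mulN1r. Qed.

Lemma udot_shift (w u : U) : udot w (shift sigma u) = udot (shiftT sigma w) u.
Proof.
rewrite /udot (reindex_inj (@perm_inj _ sigma)) /=.
by apply: eq_bigr => i _; rewrite !mxE permK.
Qed.

Lemma udot_shift' (w u : U) : udot w (shift' sigma i0 u) = udot (shift'T sigma i0 w) u.
Proof.
rewrite udotDr udotDl udot_shift udotZr [udot (_ *: _) _]udotC udotZr.
by rewrite [udot u _]udotC [udot w (delta_mx _ _)]udotC !udot_delta mulrC.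
Qed.

Lemma dual_aP w v : dot (dual_a w) (ga v) = dot w v.
Proof. by rewrite permE dot.unlock /= !(udotDl, udotDr, udotNl); ring. Qed.
Lemma dual_bP w v : dot (dual_b w) (gb v) = dot w v.
Proof.
rewrite permE dot.unlock /= /fun_b /dual_b.
move: (shift' sigma i0) (shift'T sigma i0) udot_shift' => f g fg.
by rewrite /= !(udotDl, udotDr, udotNl) fg udot_shift; ring.
Qed.
Lemma dual_cP w v : dot (dual_c w) (gc v) = dot w v.
Proof. by rewrite permE dot.unlock /= !(udotDl, udotDr, udotNl); ring. Qed.

Lemma shift_delta i : shift sigma (delta_mx 0 i : U) = delta_mx 0 (sigma i).
Proof. by apply/rowP => j; rewrite !mxE eqxx /= (canF_eq (permKV sigma)). Qed.
Lemma shiftT_delta i : shiftT sigma (delta_mx 0 (sigma i) : U) = delta_mx 0 i.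
Proof. by apply/rowP => j; rewrite !mxE eqxx /= (inj_eq perm_inj). Qed.
Lemma shift0 : shift sigma (0 : U) = 0.
Proof. by apply/rowP => j; rewrite !mxE. Qed.
Lemma shiftT0 : shiftT sigma (0 : U) = 0.
Proof. by apply/rowP => j; rewrite !mxE. Qed.
Lemma shift'_delta i : i != i0 ->
  shift' sigma i0 (delta_mx 0 i : U) = delta_mx 0 (sigma i).
Proof. by move=> ii; rewrite /shift' shift_delta mxE eq_sym (negPf ii) andbF scale0r addr0. Qed.
Lemma shift'T_delta i : sigma i != i0 ->
  shift'T sigma i0 (delta_mx 0 (sigma i) : U) = delta_mx 0 i.
Proof.
by move=> ii; rewrite /shift'T shiftT_delta mxE eq_sym (negPf ii) andbF scale0r addr0.
Qed.
Lemma shift'_delta0 :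
  shift' sigma i0 (delta_mx 0 i0 : U) = delta_mx 0 (sigma i0) + delta_mx 0 i0.
Proof. by rewrite /shift' shift_delta mxE !eqxx scale1r. Qed.
Lemma shift'T_delta0 i : sigma i = i0 ->
  shift'T sigma i0 (delta_mx 0 i0 : U) = delta_mx 0 i + delta_mx 0 i0.
Proof. by move=> ii; rewrite /shift'T -{1}ii shiftT_delta mxE !eqxx scale1r. Qed.
Lemma shift'0 : shift' sigma i0 (0 : U) = 0.
Proof. by rewrite /shift' shift0 mxE scale0r addr0. Qed.
Lemma shift'T0 : shift'T sigma i0 (0 : U) = 0.
Proof. by rewrite /shift'T shiftT0 mxE scale0r addr0. Qed.

Ltac evalv := by rewrite /xvec /yvec /mvec /ovec basis.unlock ?permE; congr (_, _, _, _) => /=;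
  rewrite ?shift'0 ?shift'T0 ?shift0 ?shiftT0 ?subr0 ?addr0 ?add0r ?sub0r.

Lemma gen_a_x i : ga (xvec i) = xvec i + mvec i. Proof. evalv. Qed.
Lemma gen_a_y i : ga (yvec i) = yvec i. Proof. evalv. Qed.
Lemma gen_b_x i : gb (xvec i) = xvec i + ovec (sigma i).
Proof.
have E := shift_delta i.
by rewrite permE /xvec /yvec /mvec /ovec basis.unlock;
congr (_, _, _, _) => /=; rewrite ?E ?shift'0 ?subr0 ?addr0 ?add0r.
Qed.
Lemma gen_b_y i : gb (yvec i) = yvec i. Proof. evalv. Qed.
Lemma gen_b_m i : i != i0 -> gb (mvec i) = mvec i + yvec (sigma i).
Proof.
move/shift'_delta=> E.
by rewrite permE /xvec /yvec /mvec /ovec basis.unlock;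
congr (_, _, _, _) => /=; rewrite ?E ?shift0 ?subr0 ?addr0 ?add0r.
Qed.
Lemma gen_b_m0 : gb (mvec i0) = mvec i0 + yvec i0 + yvec (sigma i0).
Proof.
rewrite permE /xvec /yvec /mvec /ovec basis.unlock; congr (_, _, _, _) => /=;
rewrite ?shift'_delta0 ?shift0 ?subr0 ?addr0 ?add0r //; exact: addrC.
Qed.
Lemma gen_c_x i : gc (xvec i) = xvec i. Proof. evalv. Qed.
Lemma gen_c_y i : gc (yvec i) = yvec i + xvec i. Proof. evalv. Qed.

Lemma dual_a_x i : dual_a (xvec i) = xvec i. Proof. evalv. Qed.
Lemma dual_a_y i : dual_a (yvec i) = yvec i - ovec i. Proof. evalv. Qed.
Lemma dual_a_m i : dual_a (mvec i) = mvec i - xvec i. Proof. evalv. Qed.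
Lemma dual_b_x i : dual_b (xvec i) = xvec i. Proof. evalv. Qed.
Lemma dual_b_y i : sigma i != i0 -> dual_b (yvec (sigma i)) = yvec (sigma i) - mvec i.
Proof.
move/shift'T_delta=> E.
by rewrite /xvec /yvec /mvec /ovec basis.unlock;
congr (_, _, _, _) => /=; rewrite ?E ?shiftT0 ?subr0 ?addr0 ?add0r.
Qed.
Lemma dual_b_y0 i : sigma i = i0 -> dual_b (yvec i0) = yvec i0 - (mvec i + mvec i0).
Proof.
move/shift'T_delta0=> E.
by rewrite /xvec /yvec /mvec /ovec basis.unlock;
congr (_, _, _, _) => /=; rewrite ?E ?shiftT0 ?addr0 ?subr0 ?add0r.
Qed.
Lemma dual_c_x i : dual_c (xvec i) = xvec i - yvec i. Proof. evalv. Qed.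
Lemma dual_c_y i : dual_c (yvec i) = yvec i. Proof. evalv. Qed.
Lemma dual_aD u v : dual_a (u + v) = dual_a u + dual_a v.
Proof. by congr (_, _, _, _) => //=; rewrite opprD addrACA. Qed.

End Elementary.

(** * Spreading transvections from index 0 to all pairs of basis vectors *)

Section Spread.
Variables (p n : nat) (sigma : 'S_n) (i0 : 'I_n).
Local Notation F := 'F_p.
Local Notation U := 'rV[F]_n.
Local Notation V := (quadSpace p n).
Local Notation xvec := (xvec p).
Local Notation yvec := (yvec p).
Local Notation mvec := (mvec p).
Local Notation ovec := (ovec p).
Local Notation ga := (gen_a p n).
Local Notation gb := (gen_b p sigma i0).
Local Notation gc := (gen_c p n).
Local Notation dual_b := (dual_b sigma i0).

Variable G : {group {perm V}}.
Hypotheses (Ga : ga \in G) (Gb : gb \in G) (Gc : gc \in G).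
Hypothesis sigma_neq : sigma i0 != i0.
(** That [sigma] is a single cycle is expressed as induction along it, forwards here and backwards
    in [sigmaV_ind]. *)
Hypothesis sigma_ind : forall P : 'I_n -> Prop,
  P i0 -> (forall i, P i -> P (sigma i)) -> forall i, P i.
Hypothesis sigmaV_ind : forall P : 'I_n -> Prop,
  P i0 -> (forall i, P (sigma i) -> P i) -> forall i, P i.

Local Notation T := (has_transv G).

Lemma transv_a v w : T v w -> T (ga v) (dual_a w).
Proof.
apply: transv_conj; first exact: (subsetP (normG G)).
- exact: gen_a_lin.
- exact: dual_aP.
Qed.
Lemma transv_b v w : T v w -> T (gb v) (dual_b w).
Proof.
apply: transv_conj; first exact: (subsetP (normG G)).
- exact: gen_b_lin.
- exact: dual_bP.
Qed.
Lemma transv_c v w : T v w -> T (gc v) (dual_c w).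
Proof.
apply: transv_conj; first exact: (subsetP (normG G)).
- exact: gen_c_lin.
- exact: dual_cP.
Qed.

Lemma transv_comm1 v w v' w' :
  T v w -> T v' w' -> dot w' v = 0 -> dot w v' = 1 -> T v w'.
Proof.
by move=> T1 T2 E1 E2; have := transv_comm (normG G) T1 T2 E1; rewrite E2 scale1r.
Qed.
Lemma transv_commN1 v w v' w' :
  T v w -> T v' w' -> dot w' v = 0 -> dot w v' = -1 -> T v w'.
Proof.
move=> T1 T2 E1 E2; have := transv_comm (normG G) T1 T2 E1.
by rewrite E2 scaleN1r => /transv_oppl; rewrite opprK.
Qed.

Let j := sigma i0.
Let q := (sigma^-1)%g i0.
Let sq : sigma q = i0. Proof. by rewrite /q permKV. Qed.
Let j0 : (j == i0) = false. Proof. exact: negPf. Qed.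
Let j0' : (i0 == j) = false. Proof. by rewrite eq_sym. Qed.
Let q_neq : q != i0.
Proof. by apply: contra_neq sigma_neq => q0; rewrite -{2}sq q0. Qed.
Let q0 : (q == i0) = false. Proof. exact: negPf. Qed.
Let q0' : (i0 == q) = false. Proof. by rewrite eq_sym. Qed.

Ltac dots := rewrite ?(dotDl, dotDr, dotNl, dotNr) ?dot_basis ?xpair_eqE /=
  ?eqxx ?j0 ?j0' ?q0 ?q0' /=; ring.

Let Tyx : T (yvec i0) (xvec i0).
Proof.
apply/transvP; split; first by dots.
exists [~ ga, gb]%g; first by rewrite groupR.
by move=> z; rewrite comm_ab dot_basisl.
Qed.

(** A computation in SL_2 on the plane (x_0, y_0): conjugating [Tyx] by [gc] gives (y_0 + x_0, x_0 -
    y_0), and conjugating this by the inverse of [Tyx] gives (x_0, -y_0). *)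
Let Txy : T (xvec i0) (yvec i0).
Proof.
have := transv_c Tyx; rewrite gen_c_y dual_c_x => T1.
have := transv_tconj (normG G) (transv_oppl Tyx) T1.
have -> : dot (xvec i0) (yvec i0 + xvec i0) = 1 by dots.
have -> : dot (xvec i0 - yvec i0) (- yvec i0) = 1 by dots.
have -> : yvec i0 + xvec i0 + 1 *: - yvec i0 = xvec i0 by vec.
have -> : xvec i0 - yvec i0 - 1 *: xvec i0 = - yvec i0 by vec.
by move/transv_oppr; rewrite opprK.
Qed.

(** The functional m |-> (F m)_0: the cycle carries [q] to [i0], and E_00 contributes [i0]
    itself. *)
Let mu := mvec q + mvec i0.

Let D1 : T (xvec i0 + mvec i0) (yvec i0 - ovec i0).
Proof. by have := transv_a Txy; rewrite gen_a_x dual_a_y. Qed.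

Let D2 : T (xvec i0 + ovec j) (yvec i0 - mu).
Proof. by have := transv_b Txy; rewrite gen_b_x (dual_b_y0 _ sq). Qed.

(* Conjugating D2 by two elements of SL_2(x_0, y_0) gives functionals that differ
   by y_0; their commutators with D1 isolate the transvection (m_0, y_0). *)
Let D2' : T (xvec i0 - yvec i0 + ovec j) (yvec i0 + (xvec i0 - mu)).
Proof.
have := transv_tconj (normG G) (transv_oppl Tyx) D2.
have -> : dot (xvec i0) (xvec i0 + ovec j) = 1 by dots.
have -> : dot (yvec i0 - mu) (- yvec i0) = -1 by rewrite /mu; dots.
have -> : xvec i0 + ovec j + 1 *: - yvec i0 = xvec i0 - yvec i0 + ovec j by vec.
by have -> : yvec i0 - mu - -1 *: xvec i0 = yvec i0 + (xvec i0 - mu) by vec.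
Qed.

Let D2'' : T (- yvec i0 + ovec j) (xvec i0 - mu).
Proof.
have := transv_tconj (normG G) Txy D2'.
have -> : dot (yvec i0) (xvec i0 - yvec i0 + ovec j) = -1 by dots.
have -> : dot (yvec i0 + (xvec i0 - mu)) (xvec i0) = 1 by rewrite /mu; dots.
have -> : xvec i0 - yvec i0 + ovec j + -1 *: xvec i0 = - yvec i0 + ovec j by vec.
by have -> : yvec i0 + (xvec i0 - mu) - 1 *: yvec i0 = xvec i0 - mu by vec.
Qed.

Let Tm0y : T (mvec i0) (yvec i0).
Proof.
have E1 : T (xvec i0 + mvec i0) (yvec i0 + (xvec i0 - mu)).
  by apply: transv_commN1 D1 D2' _ _; rewrite /mu; dots.
have E2 : T (xvec i0 + mvec i0) (xvec i0 - mu).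
  by apply: transv_commN1 D1 D2'' _ _; rewrite /mu; dots.
(* Cancelling [E2] leaves (x_0 + m_0, y_0); cancelling [Txy] then leaves (m_0, y_0). *)
move: E1; rewrite (addrC (yvec i0) (xvec i0 - mu)) => /(transv_cancelr E2).
exact: transv_cancell.
Qed.

Let Tm0x : T (mvec i0) (xvec i0).
Proof. by apply: transv_comm1 Tm0y Tyx _ _; dots. Qed.

(** The mirror image of the argument for [Tm0y]: two conjugates of [D1] have vectors that differ by
    x_0, and their commutators with [D2] isolate (x_0, mu). *)
Let D1' : T (xvec i0 + (yvec i0 + mvec i0)) (yvec i0 - xvec i0 - ovec i0).
Proof.
have := transv_tconj (normG G) Tyx D1.
have -> : dot (xvec i0) (xvec i0 + mvec i0) = 1 by dots.
have -> : dot (yvec i0 - ovec i0) (yvec i0) = 1 by dots.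
have -> : xvec i0 + mvec i0 + 1 *: yvec i0 = xvec i0 + (yvec i0 + mvec i0) by vec.
by have -> : yvec i0 - ovec i0 - 1 *: xvec i0 = yvec i0 - xvec i0 - ovec i0 by vec.
Qed.

Let D1'' : T (yvec i0 + mvec i0) (- xvec i0 - ovec i0).
Proof.
have := transv_tconj (normG G) (transv_oppl Txy) D1'.
have -> : dot (yvec i0) (xvec i0 + (yvec i0 + mvec i0)) = 1 by dots.
have -> : dot (yvec i0 - xvec i0 - ovec i0) (- xvec i0) = 1 by dots.
have -> : xvec i0 + (yvec i0 + mvec i0) + 1 *: - xvec i0 = yvec i0 + mvec i0 by vec.
by have -> : yvec i0 - xvec i0 - ovec i0 - 1 *: yvec i0 = - xvec i0 - ovec i0 by vec.
Qed.

Let Txmu : T (xvec i0) mu.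
Proof.
have E1 : T (xvec i0 + (yvec i0 + mvec i0)) (yvec i0 - mu).
  by apply: transv_commN1 D1' D2 _ _; rewrite /mu; dots.
have E2 : T (yvec i0 + mvec i0) (yvec i0 - mu).
  by apply: transv_commN1 D1'' D2 _ _; rewrite /mu; dots.
move: E1; rewrite addrC => /(transv_cancell E2) /(transv_cancelr Txy).
by move/transv_oppr; rewrite opprK.
Qed.

Let Tymu : T (yvec i0) mu.
Proof. by apply: transv_comm1 Tyx Txmu _ _; rewrite /mu; dots. Qed.

(* Both properties propagate along the edges of the generators, as long as
   x_0 and y_0 are avoided. *)
Let Out v := T v (xvec i0) /\ T v (yvec i0).
Let In w := T (xvec i0) w /\ T (yvec i0) w.

Let OutPx v : dot (yvec i0) v = 0 -> T v (xvec i0) -> Out v.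
Proof.
move=> E Tv; split; first exact: Tv.
apply: transv_comm1 Tv Txy E _; dots.
Qed.
Let OutPy v : dot (xvec i0) v = 0 -> T v (yvec i0) -> Out v.
Proof.
move=> E Tv; split; last exact: Tv.
apply: transv_comm1 Tv Tyx E _; dots.
Qed.
Let InPx w : dot w (yvec i0) = 0 -> T (xvec i0) w -> In w.
Proof.
move=> E Tv; split; first exact: Tv.
apply: transv_comm1 Tyx Tv E _; dots.
Qed.
Let InPy w : dot w (xvec i0) = 0 -> T (yvec i0) w -> In w.
Proof.
move=> E Tv; split; last exact: Tv.
apply: transv_comm1 Txy Tv E _; dots.
Qed.

Ltac dotsi := rewrite ?dot_basis ?xpair_eqE /=;
  repeat match goal with h : is_true (_ != _) |- _ =>
    rewrite ?(negPf h) 1?[i0 == _]eq_sym ?(negPf h); clear h end; by [].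

Let Out_yx i : i != i0 -> Out (yvec i) -> Out (xvec i).
Proof.
move=> i_neq [_ Ti]; apply: OutPy; first by dotsi.
by have := transv_c Ti; rewrite gen_c_y dual_c_y; apply: transv_cancell.
Qed.
Let Out_xm i : Out (xvec i) -> Out (mvec i).
Proof.
case=> Ti _; apply: OutPx; first by dotsi.
by have := transv_a Ti; rewrite gen_a_x dual_a_x; apply: transv_cancell.
Qed.
Let Out_xo i : Out (xvec i) -> Out (ovec (sigma i)).
Proof.
case=> Ti _; apply: OutPx; first by dotsi.
by have := transv_b Ti; rewrite gen_b_x dual_b_x; apply: transv_cancell.
Qed.
Let Out_my i : i != i0 -> sigma i != i0 -> Out (mvec i) -> Out (yvec (sigma i)).
Proof.
move=> i_neq si [Ti _]; apply: OutPx; first by clear i_neq; dotsi.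
by have := transv_b Ti; rewrite (gen_b_m p sigma i_neq) dual_b_x; apply: transv_cancell.
Qed.

(** Vectors travel forwards round the cycle, from y_i to x_i, m_i and y_(sigma i), by c, a and b in
    turn. *)
Let Out_y i : i != i0 -> Out (yvec i).
Proof.
elim/sigma_ind: i => [|i IH si]; first by rewrite eqxx.
have [->|i_neq] := eqVneq i i0.
  apply: OutPx; first by rewrite dot_basis xpair_eqE /= j0'.
  (* The chain starts at m_0, whose image under b is m_0 + y_0 + y_j; [Tm0x] and [Tyx] remove the
     first two terms. *)
  have := transv_b Tm0x; rewrite gen_b_m0 dual_b_x.
  exact: transv_cancell (transv_addl Tm0x Tyx).
by apply: Out_my => //; apply/Out_xm/Out_yx => //; apply: IH.
Qed.
Let Out_x i : i != i0 -> Out (xvec i).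
Proof. by move=> i_neq; apply/Out_yx/Out_y. Qed.
Let Out_m i : Out (mvec i).
Proof. by have [->|/Out_x/Out_xm] := eqVneq i i0. Qed.

Let In_xy i : i != i0 -> In (xvec i) -> In (yvec i).
Proof.
move=> i_neq [Ti _]; apply: InPx; first by dotsi.
have := transv_c Ti; rewrite gen_c_x dual_c_x => /(transv_cancelr Ti) /transv_oppr.
by rewrite opprK.
Qed.
Let In_yo i : In (yvec i) -> In (ovec i).
Proof.
case=> _ Ti; apply: InPy; first by dotsi.
have := transv_a Ti; rewrite gen_a_y dual_a_y => /(transv_cancelr Ti) /transv_oppr.
by rewrite opprK.
Qed.
Let In_ym i : sigma i != i0 -> In (yvec (sigma i)) -> In (mvec i).
Proof.
move=> si [_ Ti]; apply: InPy; first by dotsi.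
have := transv_b Ti; rewrite gen_b_y (dual_b_y p si) => /(transv_cancelr Ti) /transv_oppr.
by rewrite opprK.
Qed.
Let In_mx i : i != i0 -> In (mvec i) -> In (xvec i).
Proof.
move=> i_neq [_ Ti]; apply: InPy; first by dotsi.
have := transv_a Ti; rewrite gen_a_y dual_a_m => /(transv_cancelr Ti) /transv_oppr.
by rewrite opprK.
Qed.

(** Functionals travel backwards, from x_(sigma i) to y_(sigma i), m_i and x_i, by c, b and a in
    turn. *)
Let In_x i : i != i0 -> In (xvec i).
Proof.
elim/sigmaV_ind: i => [|i IH i_neq]; first by rewrite eqxx.
have [si|si] := eqVneq (sigma i) i0; last first.
  by apply/In_mx/In_ym/In_xy/IH.
(* The chain starts at [q]: a subtracts x_q + x_0 from [mu], and every term but x_q is already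
   known. *)
have -> : i = q by apply: (@perm_inj _ sigma); rewrite si sq.
apply: InPy; first by dotsi.
have := transv_a Tymu; rewrite gen_a_y dual_aD !dual_a_m.
have -> : mvec q - xvec q + (mvec i0 - xvec i0) = mu + (- xvec i0 - xvec q) by rewrite /mu; vec.
move/(transv_cancelr Tymu)/(transv_cancelr (transv_oppr Tyx))/transv_oppr.
by rewrite opprK.
Qed.
Let In_y i : i != i0 -> In (yvec i).
Proof. by move=> i_neq; apply/In_xy/In_x. Qed.
Let In_m i : In (mvec i).
Proof.
have [si|si] := eqVneq (sigma i) i0; last by apply/In_ym/In_y.
have -> : i = q by apply: (@perm_inj _ sigma); rewrite si sq.
have [T1 T2] : In (mvec i0) by apply/In_ym/In_y.
by split; [move: Txmu | move: Tymu]; rewrite /mu addrC; apply: transv_cancelr.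
Qed.

Let Out_o i : Out (ovec i).
Proof.
rewrite -[i](permKV sigma); set k := (_ i).
have [->|/Out_x/Out_xo //] := eqVneq k i0.
apply: OutPx; first by dotsi.
have [T1 _] : In (xvec j) by apply: In_x.
have [T2 _] : Out (xvec j) by apply: Out_x.
have := transv_b T1; rewrite gen_b_x dual_b_x => /(transv_cancell T1) T3.
by apply: transv_comm1 T3 T2 _ _; rewrite dot_basis ?eqxx //= xpair_eqE.
Qed.

Let In_o i : In (ovec i).
Proof.
have [->|/In_y/In_yo //] := eqVneq i i0.
(* Likewise o_0 needs a detour through y_j: conjugating (y_j, y_0) by a yields (y_j, o_0), to be
   combined with (x_0, y_j). *)
have [_ T1] : Out (yvec j) by apply: Out_y.
have [T2 _] : In (yvec j) by apply: In_y.
apply: InPx; first by dotsi.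
have := transv_a T1; rewrite gen_a_y dual_a_y => /(transv_cancelr T1)/transv_oppr.
rewrite opprK => T3.
by apply: transv_comm1 T2 T3 _ _; rewrite dot_basis ?eqxx //= xpair_eqE.
Qed.

Let Out_all s : s != (false, false, i0) -> s != (true, false, i0) -> Out (basis p s).
Proof.
case: s => [[[] []] i]; rewrite !xpair_eqE /= => h1 h2.
- exact: Out_o.
- exact: Out_y.
- exact: Out_m.
- exact: Out_x.
Qed.

Let In_all s : s != (false, false, i0) -> s != (true, false, i0) -> In (basis p s).
Proof.
case: s => [[[] []] i]; rewrite !xpair_eqE /= => h1 h2.
- exact: In_o.
- exact: In_y.
- exact: In_m.
- exact: In_x.
Qed.

(** The plane (x_0, y_0) serves as a hub: away from it, (s, t) is the commutator of (s, x_0) and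
    (x_0, t). *)
Lemma all_elementary s t : s != t -> T (basis p s) (basis p t).
Proof.
move=> st.
have [sx|sx] := eqVneq s (false, false, i0).
  have [ty|ty] := eqVneq t (true, false, i0); first by rewrite sx ty.
  by rewrite sx; apply: (In_all _ ty).1; rewrite -sx eq_sym.
have [sy|sy] := eqVneq s (true, false, i0).
  have [tx|tx] := eqVneq t (false, false, i0); first by rewrite sy tx.
  by rewrite sy; apply: (In_all tx _).2; rewrite -sy eq_sym.
have [Tsx Tsy] := Out_all sx sy.
have [->|tx] := eqVneq t (false, false, i0); first by [].
have [->|ty] := eqVneq t (true, false, i0); first by [].
have [Txt _] := In_all tx ty.
by apply: transv_comm1 Tsx Txt _ _; rewrite dot_basis ?eqxx // eq_sym (negPf st).
Qed.

End Spread.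

(** * Normal subgroups containing an elementary transvection *)

Section NormalSubgroups.
Variables (p n : nat).
Local Notation U := 'rV['F_p]_n.
Local Notation V := (quadSpace p n).

Definition elementary (G : {set {perm V}}) :=
  forall s t : vertex n, s != t -> has_transv G (basis p s) (basis p t).

(** Commutators with [G] move first the functional and then the vector. The one functional missed in
    this way, [s0], is reached through a third index. *)
Lemma elementary_normal (G K : {group {perm V}}) (s0 t0 : vertex n) :
    G \subset 'N(K)%g -> elementary G -> s0 != t0 ->
    has_transv K (basis p s0) (basis p t0) ->
  elementary K.
Proof.
move=> nKG elG st0 TK0.
have D (s t : vertex n) : s != t -> dot (basis p t) (basis p s) = 0.
  by move=> st; rewrite dot_basis eq_sym (negPf st).
have D1 (s : vertex n) : dot (basis p s) (basis p s) = 1 by rewrite dot_basis eqxx.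
have step1 t : s0 != t -> has_transv K (basis p s0) (basis p t).
  move=> st; have [<- //|tt0] := eqVneq t0 t.
  by have := transv_comm' nKG TK0 (elG _ _ tt0) (D _ _ st); rewrite D1 scale1r.
have step2 s t : s0 != t -> s != t -> has_transv K (basis p s) (basis p t).
  move=> s0t st; have [-> |ss0] := eqVneq s s0; first exact: step1.
  have := transv_comm nKG (elG _ _ ss0) (step1 _ s0t) (D _ _ st).
  by rewrite D1 scale1r.
move=> s t st; have [s0t|s0t] := eqVneq s0 t; last exact: step2.
(* There are 4n vertices, and n > 0 because [s] exists, so a third one remains. *)
have [r sr rt] : exists2 r, s != r & r != t.
  have : (0 < #|~: [set s; t]|)%N.
    rewrite cardsCs setCK cards2 st !card_prod card_bool card_ord subn_gt0.
    by rewrite (@leq_trans (2 * 2)) // leq_pmulr // (leq_ltn_trans _ (ltn_ord s.2)).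
  by case/card_gt0P=> r; rewrite !inE => /norP[rs rt]; exists r; rewrite // eq_sym.
have TKsr : has_transv K (basis p s) (basis p r).
  by apply: step2; rewrite // s0t eq_sym.
by have := transv_comm' nKG TKsr (elG _ _ rt) (D _ _ st); rewrite D1 scale1r.
Qed.

(** All the functionals kill all the vectors, so the factors do not interfere and their
    displacements add up. *)
Lemma transv_sum (K : {group {perm V}}) (I : Type) (r : seq I) (v w : I -> V) :
    (forall i j, dot (w i) (v j) = 0) ->
    (forall i, has_transv K (v i) (w i)) ->
  exists2 g, g \in K & forall z, g z = z + \sum_(i <- r) dot (w i) z *: v i.
Proof.
move=> wv TK; elim: r => [|i r [g Kg gE]].
  by exists 1%g => // z; rewrite perm1 big_nil addr0.
have /transvP[_ [h Kh hE]] := TK i.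
exists (h * g)%g; first exact: groupM.
move=> z; rewrite permM gE hE big_cons addrA; congr (_ + _).
by apply: eq_bigr => k _; rewrite dotDr dotZr wv mulr0 addr0.
Qed.

Lemma embedD l (u v : U) : embed l (u + v) = embed l u + embed l v.
Proof. by case: l => [[] []]; congr (_, _, _, _); rewrite /= ?addr0. Qed.

Lemma embedZ l k (u : U) : embed l (k *: u) = k *: embed l u.
Proof. by case: l => [[] []]; congr (_, _, _, _); rewrite /= ?scaler0. Qed.

Lemma embed_sum l (tau : 'S_n) (u : U) :
  \sum_i u 0 i *: basis p (l, tau i) = embed l (shift tau u).
Proof.
pose f (w : U) := embed l (shift tau w).
have fD : {morph f : w w' / w + w'} by move=> w w'; rewrite /f shiftD embedD.
have f0 : f 0 = 0 by rewrite /f shift0 -(scale0r (0 : U)) embedZ scale0r.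
rewrite -/(f u) [u in RHS]row_sum_delta (big_morph f fD f0).
by apply: eq_bigr => i _; rewrite /f shiftZ shift_delta embedZ basis.unlock.
Qed.

Lemma shift1 (u : U) : shift 1%g u = u.
Proof. by rewrite /shift invg1 col_perm1. Qed.

(** Each generator is a product of maps adding a permuted copy of one block to another, which are
    products of elementary transvections; for b one more transvection supplies E_00. *)
Lemma gens_elementary (sigma : 'S_n) (i0 : 'I_n) (K : {group {perm V}}) :
  elementary K ->
  [/\ gen_a p n \in K, gen_b p sigma i0 \in K & gen_c p n \in K].
Proof.
move=> elK.
have sumP (k l : bool * bool) (tau : 'S_n) : k != l ->
    exists2 g, g \in K & forall z, g z = z + embed l (shift tau (part k z)).
  move=> kl.
  have [i i'|i|g Kg gE] := @transv_sum K 'I_n (index_enum 'I_n)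
      (fun i => basis p (l, tau i)) (fun i => basis p (k, i)).
  - by rewrite dot_basis xpair_eqE (negPf kl).
  - by apply: elK; rewrite xpair_eqE eq_sym (negPf kl).
  exists g => // z; rewrite gE -embed_sum; congr (_ + _).
  by apply: eq_bigr => i _; rewrite dot_basisl.
split.
- have [g Kg gE] := sumP (false, false) (false, true) 1%g isT.
  have [h Kh hE] := sumP (true, true) (true, false) 1%g isT.
  suff -> : gen_a p n = (g * h)%g by apply: groupM.
  apply/permP => z; rewrite permM hE gE permE !shift1.
  by congr (_, _, _, _); rewrite /= ?addr0.
- have [g Kg gE] := sumP (false, false) (true, true) sigma isT.
  have [h Kh hE] := sumP (false, true) (true, false) sigma isT.
  have /transvP[_ [e Ke eE]] := elK (true, false, i0) (false, true, i0) isT.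
  suff -> : gen_b p sigma i0 = (g * h * e)%g by rewrite !groupM.
  apply/permP => z; rewrite !permM eE dot_basisl hE gE permE basis.unlock -embedZ.
  congr (_, _, _, _); rewrite /= ?addr0 //.
  by rewrite /shift' /mpart /= !addr0 addrA.
- have [g Kg gE] := sumP (true, false) (false, false) 1%g isT.
  suff -> : gen_c p n = g by [].
  apply/permP => z; rewrite gE permE shift1.
  by congr (_, _, _, _); rewrite /= ?addr0.
Qed.

End NormalSubgroups.

(** * Coordinate permutations inside the group *)

Section Permutations.
Variables (p n : nat).
Local Notation U := 'rV['F_p]_n.
Local Notation V := (quadSpace p n).
Local Notation xvec := (xvec p).
Local Notation yvec := (yvec p).
Local Notation mvec := (mvec p).

(** Acting on both x and y gives even a transposition determinant 1, as a product of transvections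
    must have. Fixing m makes the commutator in [elementary_permute] a transvection. *)
Definition permute_fun (s : 'S_n) (v : V) : V :=
  (shift s (xpart v), shift s (ypart v), mpart v, opart v).

Lemma shiftK (s : 'S_n) : cancel (@shift p n s) (shift s^-1).
Proof. by move=> u; apply/rowP => i; rewrite !mxE invgK permK. Qed.

Lemma permute_fun_inj s : injective (permute_fun s).
Proof.
apply: (can_inj (g := permute_fun s^-1)) => -[[[x y] m] o].
by congr (_, _, _, _); rewrite /= shiftK.
Qed.

Definition permute s : {perm V} := perm (@permute_fun_inj s).

Lemma permuteM : {in setT &, {morph permute : s t / (s * t)%g}}.
Proof.
move=> s t _ _; apply/permP => -[[[x y] m] o]; rewrite permM !permE.
by congr (_, _, _, _); apply/rowP => i; rewrite !mxE invMg permM.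
Qed.
Canonical permute_morphism := Morphism permuteM.

Lemma permute_lin s k u v : permute s (u + k *: v) = permute s u + k *: permute s v.
Proof.
rewrite !permE; case: u v => [[[x y] m] o] [[[x1 y1] m1] o1].
by congr (_, _, _, _) => //=; rewrite shiftD shiftZ.
Qed.

Lemma dot_permute s w v : dot (permute s w) (permute s v) = dot w v.
Proof.
have E (u u' : U) : udot (shift s u) (shift s u') = udot u u'.
  rewrite /udot (reindex_inj (@perm_inj _ s)) /=.
  by apply: eq_bigr => i _; rewrite !mxE permK.
by rewrite !permE dot.unlock /= !E.
Qed.

Lemma permute_x s i : permute s (xvec i) = xvec (s i).
Proof.
rewrite permE /xvec basis.unlock; congr (_, _, _, _) => //=; first exact: shift_delta.
exact: shift0.
Qed.
Lemma permute_m s i : permute s (mvec i) = mvec i.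
Proof.
by rewrite permE /mvec basis.unlock; congr (_, _, _, _) => //=; exact: shift0.
Qed.

Lemma permute_inj : ('injm permute_morphism)%g.
Proof.
apply/injmP => s t _ _ st; apply/permP => i.
have : dot (xvec (s i)) (xvec (t i)) = 1.
  by rewrite -!permute_x -[permute t]/(permute_morphism t) -st dot_permute dot_basis eqxx.
by rewrite dot_basis xpair_eqE /=; case: eqP.
Qed.

(* g is the square of a Weyl element of SL_2 acting on the plane (v, v'). *)
Lemma double_reflection (G : {group {perm V}}) (v v' : V) :
    (2 : 'F_p) != 0 -> has_transv G v v' -> has_transv G v' v ->
    dot v v = 2 -> dot v' v' = 2 ->
  exists2 g, g \in G & forall z, g z = z - dot v z *: v - dot v' z *: v'.
Proof.
(* Since the norms are 2, scaling by [h] turns [v] and [v'] into their dual basis. *)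
move=> two_neq0 Tvv' Tv'v vv v'v'; pose h := (2^-1 : 'F_p).
have /transvP[_ [g Gg gE]] := transv_scaler h Tvv'.
have /transvP[_ [g' Gg' gE']] := transv_oppl (transv_scaler h Tv'v).
have /transvP[v'v _] := Tvv'; have /transvP[vv' _] := Tv'v.
pose w := (g * g' * g)%g.
have wE z : w z = z + (h * (dot v' z - dot v z)) *: v
    - (h * (dot v z + dot v' z)) *: v'.
  rewrite !permM; set z1 := g z.
  have z1E : z1 = z + (h * dot v' z) *: v by rewrite /z1 gE dotZl.
  have vz1 : dot v z1 = dot v z + dot v' z.
    by rewrite z1E dotDr dotZr vv /h; field.
  have v'z1 : dot v' z1 = dot v' z by rewrite z1E dotDr dotZr v'v; ring.
  set z2 := g' z1.
  have z2E : z2 = z1 - (h * dot v z1) *: v' by rewrite /z2 gE' dotZl scalerN.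
  have v'z2 : dot v' z2 = - dot v z.
    by rewrite z2E dotDr dotNr dotZr v'v' v'z1 vz1 /h; field.
  rewrite gE dotZl v'z2 z2E vz1 z1E.
  by move: (dot v z) (dot v' z) => a b; clear; clearbody h; vec.
exists (w * w)%g; first by rewrite !groupM.
move=> z; rewrite permM; set z1 := w z; rewrite wE.
have z1E : z1 = _ := wE z.
have vz1 : dot v z1 = dot v' z.
  by rewrite z1E !(dotDr, dotNr, dotZr) vv vv' /h; field.
have v'z1 : dot v' z1 = - dot v z.
  by rewrite z1E !(dotDr, dotNr, dotZr) v'v v'v' /h; field.
rewrite vz1 v'z1 z1E; move: (dot v z) (dot v' z) => a b.
by vec_eq; rewrite /h; field.
Qed.

(* On each of the two coordinates x and y, the transposition (i j) is the
   reflection in d_i - d_j. *)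
Lemma permute_tperm (G : {group {perm V}}) i j :
  prime p -> odd p -> elementary G -> permute (tperm i j) \in G.
Proof.
move=> p_pr p_odd elG.
have [->|ij] := eqVneq i j; first by rewrite tperm1 (morph1 permute_morphism).
have two_neq0 : (2 : 'F_p) != 0.
  by rewrite -(dvdn_pcharf (pchar_Fp p_pr)) gtnNdvd // odd_prime_gt2.
have norm k : dot (basis p (k, i) - basis p (k, j)) (basis p (k, i) - basis p (k, j)) = 2.
  rewrite !(dotDl, dotDr, dotNl, dotNr) !dot_basis !xpair_eqE /= !eqxx.
  by rewrite (eq_sym j i) (negPf ij) /=; ring.
have diff k l : k != l ->
    has_transv G (basis p (k, i) - basis p (k, j)) (basis p (l, i) - basis p (l, j)).
  move=> kl; have el i1 j1 : has_transv G (basis p (k, i1)) (basis p (l, j1)).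
    by apply: elG; rewrite xpair_eqE (negPf kl).
  by apply: transv_addr; last apply: transv_oppr;
    apply: transv_addl => //; apply: transv_oppl.
have [g Gg gE] := double_reflection two_neq0 (diff (false, false) (true, false) isT)
  (diff (true, false) (false, false) isT) (norm _) (norm _).
suff -> : permute (tperm i j) = g by [].
apply/permP => z; rewrite gE permE.
have E (u : U) : shift (tperm i j) u =
    u - (u 0 i - u 0 j) *: (delta_mx 0 i - delta_mx 0 j).
  apply/rowP => k; rewrite !mxE tpermV /=.
  case: tpermP => [->|->|]; rewrite ?eqxx ?(negPf ij) 1?(eq_sym j i) ?(negPf ij) /=.
  - by ring.
  - by ring.
  by move=> /eqP/negPf-> /eqP/negPf->; ring.
rewrite !(dotDl, dotNl) !dot_basisl basis.unlock.
by congr (_, _, _, _); rewrite /= ?E ?subr0 ?scaler0 ?oppr0 ?addr0.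
Qed.

Lemma permute_sub (G : {group {perm V}}) :
  prime p -> odd p -> elementary G -> (permute_morphism @* setT)%g \subset G.
Proof.
move=> p_pr p_odd elG; apply/subsetP => _ /morphimP[s _ _ ->].
have [ts -> _] := prod_tpermP s; elim/big_ind: _ => //.
- by rewrite morph1.
- by move=> t t' Gt Gt'; rewrite morphM ?inE // groupM.
by move=> t _; apply: permute_tperm.
Qed.

(** As [permute s] fixes m_i and moves x_i, its commutator with (m_i, x_i) is (m_i, x_(s i) - x_i).
    A further commutator with (x_i, y_i) gives (m_i, y_i) up to sign. *)
Lemma elementary_permute (G K : {group {perm V}}) (s : 'S_n) i :
    elementary G -> G \subset 'N(K)%g -> s i != i -> permute s \in K ->
  elementary K.
Proof.
move=> elG nKG si Ks.
have T0 : has_transv G (mvec i) (xvec i) by apply: elG.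
have /transvP[_ [g Gg gE]] := T0.
have T1 : has_transv K (mvec i) (xvec (s i) - xvec i).
  apply/transvP; split.
    by rewrite dotDl dotNl !dot_basis !xpair_eqE /= subr0.
  exists [~ g, permute s]%g.
    by rewrite commgEr groupM // memJ_norm ?groupV // (subsetP nKG).
  apply: commg_permE => z; rewrite !gE permute_lin permute_m.
  rewrite -(dot_permute s (xvec i)) permute_x.
  rewrite !(dotDl, dotNl, dotDr, dotZr) !dot_basis !xpair_eqE /=.
  by vec.
have := transv_comm' nKG T1 (elG (false, false, i) (true, false, i) isT).
rewrite dot_basis xpair_eqE /= => /(_ erefl).
rewrite dotDl dotNl !dot_basis !xpair_eqE /= eqxx (negPf si).
rewrite sub0r scaleN1r => /transv_oppl; rewrite opprK.
exact: (@elementary_normal _ _ G K (false, true, i) (true, false, i)).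
Qed.

End Permutations.

Local Open Scope group_scope.

(** * Finite quotients of a presented group and their alternating subgroups *)

Section PresentedImage.
Variables (X : Type) (R : seq (gword X)) (gT : finGroupType) (f : X -> gT).
Variables (G K : {group gT}).
Hypothesis fR : forall r, r \in R -> gword_eval f r = 1.
Hypothesis genG : forall H : {group gT}, (forall x, f x \in H) -> G \subset H.
Hypothesis fG : forall x, f x \in G.
Hypothesis nKG : G \subset 'N(K).

Lemma presented_quotient : finite_quotient (presented R) (G / K)%G.
Proof.
have [F Fgen] := presented_universal fR.
have F1 : F 1 = 1 by apply: (mulgI (F 1)); rewrite -gmulfM !mulg1.
have FV u : F u^-1 = (F u)^-1 by apply: (mulgI (F u)); rewrite -gmulfM !mulgV.
have classM u v : pres_class R (u * v) = (pres_class R u : presented R) * pres_class R v.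
  by rewrite -pres_class_mul.
have classV u : pres_class R u^-1 = (pres_class R u : presented R)^-1.
  by rewrite -pres_class_inv.
(* [coset K] is multiplicative only on the normaliser of [K], so the values of [F] must be known to
   lie in [G]. *)
have FG x : F x \in G.
  rewrite -(pres_repr x); elim: (generic_quotient.repr x) => [y||u IHu v IHv|u IHu].
  - by rewrite Fgen.
  - by rewrite -[pres_class _ _]/(1 : presented R) F1.
  - by rewrite classM gmulfM groupM.
  - by rewrite classV FV groupV.
pose h x := coset K (F x).
have hM : {morph h : x y / x * y}.
  by move=> x y; rewrite /h gmulfM morphM ?(subsetP nKG).
pose mh := isMultiplicative.Build (presented R) (coset_of K) h hM.
pose sh : {multiplicative presented R -> coset_of K} := HB.pack h mh.
exists sh => y; split=> [|[x <-]]; last by apply: mem_quotient.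
case/morphimP=> z Nz Gz ->.
(* The image of [F] is a subgroup containing the generators, hence contains [G]; this gives
   surjectivity. *)
pose I := [set w | `[< exists x, F x = w >]].
have gI : group_set I.
  apply/group_setP; split; first by rewrite inE; apply/asboolP; exists 1.
  move=> u v; rewrite !inE => /asboolP[x <-] /asboolP[x' <-].
  by apply/asboolP; exists (x * x'); rewrite gmulfM.
have /subsetP/(_ z Gz) : G \subset Group gI.
  by apply: genG => x; rewrite inE; apply/asboolP; exists (pres_class R (WGen x)).
by rewrite inE => /asboolP[x <-]; exists x.
Qed.

End PresentedImage.

(** Alt(d) embeds in Alt(d+1) as the stabiliser of the point 0. This allows a degree larger than the
    required one. *)
Lemma simple_containing_Alt_pred d (gT : finGroupType) (S : {group gT}) :
  simple_containing_Alt d.+1 S -> simple_containing_Alt d S.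
Proof.
case=> simS [A sAS isoA]; split=> //.
pose f (s : 'S_d) : 'S_d.+1 := lift_perm ord0 ord0 s.
have fM : {in setT &, {morph f : s t / s * t}} by move=> s t _ _; rewrite /f lift_permM.
pose fm := Morphism fM.
have injf : 'injm fm.
  apply/injmP => s t _ _ /permP st; apply/permP => i.
  by have := st (lift ord0 i); rewrite /= !lift_perm_lift => /lift_inj.
have fAlt : fm @* 'Alt_('I_d) \subset 'Alt_('I_d.+1).
  apply/subsetP => _ /morphimP[s _ + ->].
  by rewrite !Alt_even /= odd_lift_perm.
have /isogP[g injg gA] := isoA.
exists (g @* (fm @* 'Alt_('I_d)))%G.
  by apply: subset_trans sAS; rewrite -gA morphimS.
apply: isog_trans (sub_isog (subsetT _) injf) _.
exact: sub_isog.
Qed.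

Lemma simple_containing_Alt_leq d e (gT : finGroupType) (S : {group gT}) :
  (d <= e)%N -> simple_containing_Alt e S -> simple_containing_Alt d S.
Proof.
move=> /subnK <-; elim: (e - d)%N => // k IH; rewrite addSn => /simple_containing_Alt_pred.
exact: IH.
Qed.

(* If the normal closure of A in G is G, then A meets every maximal normal
   subgroup of G trivially. *)
Lemma simple_quotient_containing (gT : finGroupType) (G A : {group gT}) :
    simple A -> A \subset G ->
    (forall K : {group gT}, K <| G -> A \subset K -> G \subset K) ->
  exists2 K : {group gT}, G \subset 'N(K) &
    simple (G / K) /\ exists2 B : {group coset_of K}, B \subset G / K & A \isog B.
Proof.
move=> simA sAG clA.
have ntG : G :!=: 1.
  have [ntA _] := simpleP _ simA.
  by apply: contraNneq ntA => G1; apply/eqP/trivgP; rewrite -G1.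
have [K maxK] := ex_maxnormal_ntrivg ntG.
have nsKG := maxnormal_normal maxK; have nKG := normal_norm nsKG.
exists K => //; split; first by rewrite quotient_simple.
have tiKA : K :&: A = 1.
  have nsKA : K :&: A <| A by rewrite setIC (normalGI sAG).
  have [_ /(_ _ nsKA)[] // /setIidPr sAK] := simpleP _ simA.
  by case/andP: (maxnormal_proper maxK) => _; rewrite clA.
exists (A / K)%G; first exact: quotientS.
by apply: quotient_isog tiKA; apply: subset_trans nKG.
Qed.

(** * The cyclic shift and the conclusion *)

Section CyclicShift.
Local Open Scope ring_scope.
Variable n : nat.

Definition cycle_shift : 'S_n.+2 := perm (addIr (1 : 'I_n.+2)).

Lemma cycle_shift_ind (P : 'I_n.+2 -> Prop) :
  P 0 -> (forall i, P i -> P (cycle_shift i)) -> forall i, P i.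
Proof.
move=> P0 IH i; rewrite -[i]natr_Zp; elim: (nat_of_ord i) => // k /IH.
by rewrite permE -mulrSr.
Qed.

Lemma cycle_shiftV_ind (P : 'I_n.+2 -> Prop) :
  P 0 -> (forall i, P (cycle_shift i) -> P i) -> forall i, P i.
Proof.
move=> P0 IH i; rewrite -[i]opprK -[- i]natr_Zp.
elim: (nat_of_ord _) => [|k Pk]; first by rewrite oppr0.
by apply: IH; rewrite permE mulrSr opprD subrK.
Qed.

End CyclicShift.

Theorem theorem1p4 (p : nat) (p_prime : prime p) (p_odd : odd p) :
  simple_quotients_of_large_rank (G_HB22 p).
Proof.
(* With n = d + 5 the group Alt(n) is simple and contains Alt(d). *)
move=> d; pose n := d.+3.+2; pose sigma : 'S_n := cycle_shift d.+3.
pose f := gen p sigma (0%R : 'I_n).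
pose G := <<[set f GenA; f GenB; f GenC]>>%G.
have fG x : f x \in G by apply: mem_gen; case: x; rewrite !inE eqxx ?orbT.
have genG (H : {group {perm quadSpace p n}}) : (forall x, f x \in H) -> G \subset H.
  move=> fH; rewrite gen_subG; apply/subsetP => x.
  by rewrite !inE => /orP[/orP[]|] /eqP->.
have elG : elementary G.
  apply: (all_elementary (sigma := sigma) (i0 := 0%R)).
  - exact: (fG GenA).
  - exact: (fG GenB).
  - exact: (fG GenC).
  - by rewrite permE add0r oner_eq0.
  - exact: cycle_shift_ind.
  - exact: cycle_shiftV_ind.
pose A := (permute_morphism p n @* 'Alt_('I_n))%G.
have isoA : 'Alt_('I_n) \isog A by apply: sub_isog (subsetT _) (permute_inj p n).
have simAlt : simple 'Alt_('I_n) by apply: simple_Alt5; rewrite card_ord.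
have simA : simple A by rewrite -(isog_simple isoA).
have sAG : A \subset G.
  by apply: subset_trans (permute_sub p_prime p_odd elG); apply: morphimS (subsetT _).
have [K nKG [simGK [B sB isoB]]] : exists2 K : {group {perm quadSpace p n}},
    G \subset 'N(K) &
    simple (G / K) /\ exists2 B : {group coset_of K}, B \subset G / K & A \isog B.
  apply: simple_quotient_containing => // K nsKG sAK; apply: genG.
  pose i k : 'I_n := inord k.
  (* A 3-cycle: an even permutation that moves the point [i 0]. *)
  pose s := tperm (i 0%N) (i 1%N) * tperm (i 0%N) (i 2).
  have ineq k l : (k < 3)%N -> (l < 3)%N -> k != l -> i k != i l.
    move=> k3 l3; apply: contra_neq => /(congr1 val).
    by rewrite /= !inordK // (leq_trans _ (_ : (3 <= n)%N)).
  have s0 : s (i 0%N) != i 0%N.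
    by rewrite permM tpermL tpermD ?ineq // eq_sym ineq.
  have Alts : s \in 'Alt_('I_n).
    by rewrite Alt_even odd_permM !odd_tperm !ineq.
  have elK : elementary K.
    apply: elementary_permute elG (normal_norm nsKG) s0 _.
    apply: (subsetP sAK).
    exact: (mem_morphim (permute_morphism p n) (in_setT s) Alts).
  have [Ka Kb Kc] := gens_elementary sigma 0%R elK.
  by case.
exists (coset_of K), (G / K)%G; split.
  apply: (@presented_quotient _ _ _ f G K _ genG fG nKG) => r.
  exact: gen_relators.
apply: (@simple_containing_Alt_leq _ n); first by rewrite /n !leqW.
split=> //; exists B => //; exact: isog_trans isoA isoB.
Qed.
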